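(* Fix $\alpha,\beta>0$. For $n\ge2$ let $S$ be a random $\alpha/\beta$-staircase tableau of size $n$ with law $\mathbb{P}_{n,\alpha,\beta}$, and let $X_n$ be the number of non-empty boxes among the boxes $(n-j,j)$, $1\le j\le n-1$ (the second main diagonal). Then, as $n\to\infty$, $X_n$ converges in distribution to a Poisson random variable with parameter $1$.
   Context: A staircase tableau of size $n$ has boxes $(i,j)$ with $i,j\ge1$ and $i+j\le n+1$, rows numbered from the top and columns from the left. An $\alpha/\beta$-staircase tableau of size $n$ is a filling in which each box is empty or contains $\alpha$ or $\beta$, such that: all boxes in the same column and above an $\alpha$ are empty; all boxes in the same row and to the left of a $\beta$ are empty; every main-diagonal box (with $i+j=n+1$) contains a symbol. $\overline{\mathcal{S}}_n$ is the set of these. The weight is $wt(S)=\alpha^{N_\alpha}\beta^{N_\beta}$ ($N_\alpha,N_\beta$ the numbers of $\alpha$'s, $\beta$'s), and $\mathbb{P}_{n,\alpha,\beta}(S)=wt(S)/\sum_{T\in\overline{\mathcal{S}}_n}wt(T)$. *)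

(* Defs.v *)
From HB Require Import structures.
From mathcomp Require Import all_boot all_order all_algebra.
From mathcomp Require Import all_classical all_reals all_analysis.
Set Implicit Arguments. Unset Strict Implicit. Unset Printing Implicit Defensive.
Import Order.TTheory GRing.Theory Num.Theory.
Local Open Scope ring_scope.

Definition cell := option bool.
Definition calpha : cell := Some true.
Definition cbeta : cell := Some false.

(* A filling of the n x n square; boxes are indexed 0-based: the paper's box
   (i,j) (1-based, i+j <= n+1) is (i-1, j-1), i.e. (i0,j0) with i0+j0 < n. *)
Definition filling (n : nat) := {ffun 'I_n * 'I_n -> cell}.

Definition in_staircase (n : nat) (p : 'I_n * 'I_n) : bool := (p.1 + p.2 < n)%N.

Definition is_ab_staircase (n : nat) (S : filling n) : bool :=
  [forall p : 'I_n * 'I_n, ~~ in_staircase p ==> (S p == None)] &&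
  [forall p : 'I_n * 'I_n, (S p == calpha) ==>
     [forall i : 'I_n, (i < p.1)%N ==> (S (i, p.2) == None)]] &&
  [forall p : 'I_n * 'I_n, (S p == cbeta) ==>
     [forall j : 'I_n, (j < p.2)%N ==> (S (p.1, j) == None)]] &&
  (* every main-diagonal box (i+j = n+1, 1-based) contains a symbol *)
  [forall p : 'I_n * 'I_n, ((p.1 + p.2).+1 == n) ==> (S p != None)].

Definition Nalpha (n : nat) (S : filling n) : nat := #|[set p | S p == calpha]|.
Definition Nbeta (n : nat) (S : filling n) : nat := #|[set p | S p == cbeta]|.

Definition wt {R : numFieldType} (a b : R) (n : nat) (S : filling n) : R :=
  a ^+ Nalpha S * b ^+ Nbeta S.

(* X_n: number of non-empty boxes on the second main diagonal, i.e. the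
   paper's boxes (n-j, j), 1 <= j <= n-1, i.e. 0-based i0 + j0 = n - 2. *)
Definition Xsecond (n : nat) (S : filling n) : nat :=
  #|[set p : 'I_n * 'I_n | ((p.1 + p.2).+2 == n) && (S p != None)]|.

Definition prob_X_eq {R : numFieldType} (a b : R) (n k : nat) : R :=
  (\sum_(S : filling n | is_ab_staircase S && (Xsecond S == k)) wt a b S) /
  (\sum_(S : filling n | is_ab_staircase S) wt a b S).

(* Main.v *)
(** Build a tableau of size n+1 from one of size n by adding a new first column.
    Let F_n(x) be the sum of wt(S) t^X(S) x^(number of rows of S without beta).
    A column has at most one alpha, with nothing above it, and its entries lie in
    the new bottom row or in beta-free rows; summing over the columns telescopes to
      F_(n+2)(x) = (b + a x) (F_(n+1)(x + b) + a b (t - 1) F_n(x + b)),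
    where F_n comes from the tableaux with an alpha in the bottom corner: only in
    front of this alpha can the new column fill its second-diagonal box.  With
    Z_n(x) the product of the b + a (x + i b), i < n, the solution is
      F_n(x) = sum_r C(n-r, r) (a b (t - 1))^r Z_(n-r)(x).
    Extracting the coefficient of t^k at x = 1 and dividing by Z_n(1) gives a sum over
    r whose terms tend to (-1)^(r-k) C(r, k) / r! and are dominated by C(r, k) / r!,
    so dominated convergence yields e^(-1) / k!. *)

Require Import Defs.
From HB Require Import structures.
From mathcomp Require Import all_boot all_order all_algebra.
From mathcomp Require Import ring lra.
From mathcomp Require Import all_classical all_reals all_analysis.
Import Order.TTheory GRing.Theory Num.Theory numFieldNormedType.Exports.
Local Open Scope classical_set_scope.
Local Open Scope ring_scope.
Set Implicit Arguments. Unset Strict Implicit.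

(** * Splitting a tableau into its first column and a smaller tableau *)

Lemma staircaseP (n : nat) (S : filling n) :
  reflect [/\ forall i j : 'I_n, (n <= i + j)%N -> S (i, j) = None,
     forall i j i' : 'I_n, S (i, j) = calpha -> (i' < i)%N -> S (i', j) = None,
     forall i j j' : 'I_n, S (i, j) = cbeta -> (j' < j)%N -> S (i, j') = None &
     forall i j : 'I_n, (i + j).+1 = n -> S (i, j) <> None]
  (is_ab_staircase S).
Proof.
apply: (iffP idP).
  case/andP => /andP[/andP[/forallP H1 /forallP H2] /forallP H3] /forallP H4.
  split.
  - move=> i j le; apply/eqP; move/implyP: (H1 (i, j)); apply.
    by rewrite /in_staircase /= -leqNgt.
  - move=> i j i' /eqP Sa lt; apply/eqP.
    by move/implyP/(_ Sa)/forallP/(_ i')/implyP: (H2 (i, j)); apply.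
  - move=> i j j' /eqP Sa lt; apply/eqP.
    by move/implyP/(_ Sa)/forallP/(_ j')/implyP: (H3 (i, j)); apply.
  - by move=> i j /eqP e; apply/eqP; move/implyP: (H4 (i, j)); apply.
case=> H1 H2 H3 H4; rewrite /is_ab_staircase -!andbA; apply/and4P; split.
- apply/forallP => -[i j]; apply/implyP; rewrite /in_staircase /= -leqNgt => le.
  by rewrite H1.
- apply/forallP => -[i j]; apply/implyP => /eqP Sa.
  by apply/forallP => i'; apply/implyP => lt; rewrite (H2 i j).
- apply/forallP => -[i j]; apply/implyP => /eqP Sa.
  by apply/forallP => j'; apply/implyP => lt; rewrite (H3 i j).
- by apply/forallP => -[i j]; apply/implyP => /eqP e; apply/eqP; exact: H4.
Qed.

Definition column (n : nat) := {ffun 'I_n -> cell}.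

Definition column_ok (n : nat) (c : column n) : bool :=
  [forall i, (c i == calpha) ==> [forall j : 'I_n, (j < i)%N ==> (c j == None)]].

Definition beta_free (n : nat) (S : filling n) (i : 'I_n) : bool :=
  [forall j, S (i, j) != cbeta].

(** The conditions that tie a new first column to [S]: its bottom entry is a main-diagonal box, and
    a row that already holds a [cbeta] must stay empty to the left of it. *)
Definition column_fits (n : nat) (S : filling n) (c : column n.+1) : bool :=
  (c ord_max != None) &&
  [forall i, beta_free S i || (c (lift ord_max i) == None)].

(** An old box [(i, j)] moves to [(i, j + 1)], so it keeps its distance to the main diagonal of the
    larger staircase. *)
Definition add_column (n : nat) (S : filling n) (c : column n.+1) : filling n.+1 :=
  [ffun p => if unlift ord0 p.2 is Some j then
     if unlift ord_max p.1 is Some i then S (i, j) else None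
   else c p.1].

Definition first_column (n : nat) (S : filling n.+1) : column n.+1 :=
  [ffun i => S (i, ord0)].

Definition drop_column (n : nat) (S : filling n.+1) : filling n :=
  [ffun p => S (lift ord_max p.1, lift ord0 p.2)].

Lemma add_column0 n (S : filling n) c i : add_column S c (i, ord0) = c i.
Proof. by rewrite ffunE /= unlift_none. Qed.

Lemma add_column_lift n (S : filling n) c i j :
  add_column S c (lift ord_max i, lift ord0 j) = S (i, j).
Proof. by rewrite ffunE /= !liftK. Qed.

Lemma add_column_max n (S : filling n) c j :
  add_column S c (ord_max, lift ord0 j) = None.
Proof. by rewrite ffunE /= liftK unlift_none. Qed.

Lemma add_columnK n (S : filling n) c :
  (drop_column (add_column S c), first_column (add_column S c)) = (S, c).
Proof.
congr pair; apply/ffunP; first by case=> i j; rewrite ffunE add_column_lift.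
by move=> i; rewrite ffunE add_column0.
Qed.

(** The bottom row meets the staircase only in its first box, so dropping that row together with the
    first column loses nothing but [first_column S]. *)
Lemma drop_columnK n (S : filling n.+1) : is_ab_staircase S ->
  add_column (drop_column S) (first_column S) = S.
Proof.
case/staircaseP => H1 _ _ _; apply/ffunP => -[i j].
case: (unliftP ord0 j) => [j' ->|->]; last by rewrite add_column0 ffunE.
case: (unliftP ord_max i) => [i' ->|->]; first by rewrite add_column_lift ffunE.
by rewrite add_column_max H1 //= /bump /= !add1n addnS ltnS leq_addr.
Qed.

Lemma beta_freeP n (S : filling n) i :
  reflect (forall j, S (i, j) <> cbeta) (beta_free S i).
Proof. by apply: (iffP forallP) => H j; apply/eqP; exact: H. Qed.

(** The new column lies to the left of all old boxes: a [calpha] in it constrains only the column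
    itself, a [cbeta] in it constrains nothing, and an old [cbeta] empties the new box of its
    row. *)
Lemma add_column_staircase n (S : filling n) c :
  is_ab_staircase (add_column S c) =
  [&& is_ab_staircase S, column_ok c & column_fits S c].
Proof.
have lm (i : 'I_n) : lift ord_max i = i :> nat by rewrite lift_max.
have l0 (i : 'I_n) : lift ord0 i = i.+1 :> nat by rewrite lift0.
apply/staircaseP/and3P.
  case=> H1 H2 H3 H4; split.
  - apply/staircaseP; split.
    + move=> i j le; rewrite -(add_column_lift S c) H1 // lm l0 addnS ltnS //.
    + move=> i j i'; rewrite -!(add_column_lift S c) => Sa lt.
      by apply: H2 Sa _; rewrite !lm.
    + move=> i j j'; rewrite -!(add_column_lift S c) => Sa lt.
      by apply: H3 Sa _; rewrite !l0.
    + move=> i j e; rewrite -(add_column_lift S c); apply: H4.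
      by rewrite lm l0 addnS e.
  - apply/forallP => i; apply/implyP => /eqP ci; apply/forallP => j.
    apply/implyP => lt; rewrite -(add_column0 S c j); apply/eqP.
    by apply: (H2 i) lt; rewrite add_column0.
  - apply/andP; split.
      by apply/eqP; rewrite -(add_column0 S c); apply: H4; rewrite addn0.
    apply/forallP => i; case: (boolP (beta_free S i)) => //= /forallPn[j].
    rewrite negbK => /eqP Sb; rewrite -(add_column0 S c); apply/eqP.
    by apply: (H3 _ (lift ord0 j)); rewrite ?add_column_lift ?l0.
case=> /staircaseP[H1 H2 H3 H4] /forallP ok /andP[cm /forallP fit]; split.
- move=> i j; case: (unliftP ord0 j) => [j' ->|->]; last first.
    by rewrite addn0 leqNgt ltn_ord.
  case: (unliftP ord_max i) => [i' ->|->]; last by rewrite add_column_max.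
  by rewrite add_column_lift lm l0 addnS ltnS; exact: H1.
- move=> i j i'; case: (unliftP ord0 j) => [j' ->|->].
    case: (unliftP ord_max i) => [k ->|->]; last by rewrite add_column_max.
    case: (unliftP ord_max i') => [k' ->|->]; last by rewrite add_column_max.
    by rewrite !add_column_lift !lm; exact: H2.
  rewrite !add_column0 => /eqP ci lt; apply/eqP.
  by move/implyP/(_ ci)/forallP/(_ i')/implyP: (ok i); apply.
- move=> i j j'; case: (unliftP ord0 j) => [k ->|->//].
  case: (unliftP ord_max i) => [k' ->|->]; last by rewrite add_column_max.
  rewrite add_column_lift => Sb; case: (unliftP ord0 j') => [l ->|->].
    by rewrite add_column_lift !l0 => lt; apply: H3 Sb lt.
  rewrite add_column0 => _; have /orP[/beta_freeP/(_ k)//|/eqP//] := fit k'.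
- move=> i j; case: (unliftP ord0 j) => [j' ->|->].
    case: (unliftP ord_max i) => [i' ->|->].
      by rewrite add_column_lift lm l0 addnS => -[]; exact: H4.
    by rewrite l0 /= => -[]; rewrite addnS => /eqP; rewrite eqn_leq ltnNge leq_addr.
  rewrite add_column0 addn0 => -[e]; have -> : i = ord_max by exact: val_inj.
  exact/eqP.
Qed.

Lemma sum_staircaseS (K : nmodType) n (f : filling n.+1 -> K) :
  \sum_(S | is_ab_staircase S) f S =
  \sum_(S : filling n | is_ab_staircase S)
    \sum_(c | column_ok c && column_fits S c) f (add_column S c).
Proof.
rewrite (reindex_onto (fun p => add_column p.1 p.2)
  (fun S => (drop_column S, first_column S))) /=; last exact: drop_columnK.
rewrite pair_big_dep /=; apply: eq_bigl => -[S c] /=.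
by rewrite add_columnK eqxx andbT add_column_staircase.
Qed.

(** * Weighted sums over the fillings of one column *)

Definition snoc_column n (c : column n) (s : cell) : column n.+1 :=
  [ffun i => if unlift ord_max i is Some j then c j else s].

Lemma snoc_column_max n (c : column n) s : snoc_column c s ord_max = s.
Proof. by rewrite ffunE unlift_none. Qed.

Lemma snoc_column_lift n (c : column n) s i :
  snoc_column c s (lift ord_max i) = c i.
Proof. by rewrite ffunE liftK. Qed.

(** The condition on [calpha] only looks upwards, so a new bottom entry matters only if it is itself
    [calpha], and then everything above it is empty. *)
Lemma snoc_column_ok n (c : column n) s :
  column_ok (snoc_column c s) =
  column_ok c && ((s == calpha) ==> (c == [ffun => None])).
Proof.
have lm (i : 'I_n) : lift ord_max i = i :> nat by rewrite lift_max.
apply/forallP/andP => [ok|[/forallP ok /implyP sok] i]; last first.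
  apply/implyP; case: (unliftP ord_max i) => [k ->|->].
    rewrite snoc_column_lift => ck; apply/forallP => j; apply/implyP.
    case: (unliftP ord_max j) => [l ->|->]; rewrite !lm.
      rewrite snoc_column_lift => lt.
      by move/implyP/(_ ck)/forallP/(_ l)/implyP: (ok k); apply.
    by rewrite ltnNge (ltnW (ltn_ord k)).
  rewrite snoc_column_max => /sok/eqP ->; apply/forallP => j; apply/implyP.
  case: (unliftP ord_max j) => [l ->|->]; last by rewrite ltnn.
  by rewrite snoc_column_lift ffunE.
split.
  apply/forallP => i; apply/implyP => ci; apply/forallP => j; apply/implyP => lt.
  move/implyP: (ok (lift ord_max i)); rewrite snoc_column_lift => /(_ ci).
  by move/forallP/(_ (lift ord_max j)); rewrite snoc_column_lift !lm lt.
apply/implyP => sa; apply/eqP/ffunP => i; rewrite ffunE; apply/eqP.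
move/implyP: (ok ord_max); rewrite snoc_column_max => /(_ sa).
by move/forallP/(_ (lift ord_max i)); rewrite snoc_column_lift lm /= ltn_ord.
Qed.

Lemma column_ok_none n : column_ok ([ffun=> None] : column n).
Proof. by apply/forallP => i; rewrite ffunE. Qed.

Definition column_sum (K : comNzRingType) n (g : 'I_n -> cell -> K) : K :=
  \sum_(c : column n | column_ok c) \prod_i g i (c i).

Lemma column_sum0 (K : comNzRingType) (g : 'I_0 -> cell -> K) : column_sum g = 1.
Proof.
rewrite /column_sum (big_pred1 [ffun=> None]); first by rewrite big_ord0.
move=> c; have -> : c = [ffun=> None] by apply/ffunP => -[].
by rewrite /= eqxx column_ok_none.
Qed.

Lemma sum_cell (K : nmodType) (f : cell -> K) :
  \sum_s f s = f None + (f calpha + f cbeta).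
Proof.
rewrite (bigD1 None) //= (bigD1 calpha) //= (bigD1 cbeta) //= big1 ?addr0 //.
by case=> [[]|].
Qed.

(** Split by the bottom entry: [calpha] leaves only the empty column above, while [None] and [cbeta]
    leave the upper part free. *)
Lemma column_sumS (K : comNzRingType) n (g : 'I_n.+1 -> cell -> K) :
  let g' := fun i => g (lift ord_max i) in
  column_sum g = g ord_max calpha * \prod_i g' i None +
    (g ord_max None + g ord_max cbeta) * column_sum g'.
Proof.
rewrite /column_sum /=.
rewrite (reindex_onto (fun p => snoc_column p.2 p.1)
  (fun c => (c ord_max, [ffun i => c (lift ord_max i)]))) /=; last first.
  move=> c _; apply/ffunP => i; case: (unliftP ord_max i) => [j ->|->].
    by rewrite snoc_column_lift ffunE.
  by rewrite snoc_column_max.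
transitivity (\sum_(s : cell) \sum_(c : column n | column_ok c &&
   ((s == calpha) ==> (c == [ffun => None])))
   g ord_max s * \prod_i g (lift ord_max i) (c i)).
  rewrite pair_big_dep /=; apply: eq_big => -[s c] /=.
    rewrite snoc_column_ok snoc_column_max.
    have -> : [ffun i => snoc_column c s (lift ord_max i)] = c.
      by apply/ffunP => i; rewrite ffunE snoc_column_lift.
    by rewrite eqxx andbT.
  move=> _; rewrite (bigD1_ord ord_max) //= snoc_column_max; congr (_ * _).
  by apply: eq_bigr => i _; rewrite snoc_column_lift.
rewrite sum_cell -!big_distrr /= addrCA; congr (_ + _).
  congr (_ * _); rewrite (big_pred1 [ffun=> None]).
    by apply: eq_bigr => i _; rewrite ffunE.
  move=> c /=; case: eqVneq => [->|]; last by rewrite andbF.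
  by rewrite column_ok_none.
by rewrite mulrDl; congr (_ * _ + _ * _); apply: eq_bigl => c; rewrite andbT.
Qed.

(** * The generating function and its recursion *)

Section Weights.
Variables (K : comNzRingType) (a b t : K).

Definition cell_weight (s : cell) : K :=
  if s is Some s' then if s' then a else b else 1.

Definition mark (second : bool) (s : cell) : K :=
  if second && (s != None) then t else 1.

Definition marked_wt n (S : filling n) : K :=
  \prod_p (cell_weight (S p) * mark ((p.1 + p.2).+2 == n) (S p)).

Definition row_weight (x : K) (free : bool) : K := if free then x else 1.

(** This is F_n(x) of the overview. The variable [x] is needed for the recursion, since the rows it
    counts are those that can receive further symbols. *)
Definition tableau_gf n (x : K) : K :=
  \sum_(S : filling n | is_ab_staircase S)
    marked_wt S * \prod_i row_weight x (beta_free S i).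

Lemma marked_wtE n (S : filling n) :
  marked_wt S = a ^+ Nalpha S * b ^+ Nbeta S * t ^+ Xsecond S.
Proof.
rewrite /marked_wt /Nalpha /Nbeta /Xsecond -!prodr_const.
rewrite ![\prod_(i in _) _]big_mkcond -!big_split; apply: eq_bigr => p _ /=.
rewrite !inE /cell_weight /mark; case: (S p) => [[]|] /=;
  by rewrite ?eqxx ?andbT ?andbF ?mul1r ?mulr1 //; case: ifP; rewrite ?mul1r ?mulr1.
Qed.

Lemma marked_wt_by_columns n (S : filling n) :
  marked_wt S = \prod_j \prod_i
    (cell_weight (S (i, j)) * mark ((i + j).+2 == n) (S (i, j))).
Proof.
by rewrite exchange_big pair_bigA; apply: eq_bigr => -[i j].
Qed.

(** Old second-diagonal boxes stay on the second diagonal, and the new column has its own such box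
    in the last old row, whence the test [i.+1 == n]. *)
Lemma marked_wt_add_column n (S : filling n) c :
  marked_wt (add_column S c) =
  marked_wt S * \prod_(i : 'I_n.+1) (cell_weight (c i) * mark (i.+1 == n) (c i)).
Proof.
rewrite !marked_wt_by_columns.
rewrite (bigD1_ord ord0) //= mulrC; congr (_ * _); last first.
  by apply: eq_bigr => i _; rewrite add_column0 addn0 eqSS.
apply: eq_bigr => j _; rewrite (bigD1_ord ord_max) //= add_column_max.
rewrite /mark andbF !mul1r; apply: eq_bigr => i _.
by rewrite add_column_lift /bump leqNgt ltn_ord /= add0n add1n addnS eqSS.
Qed.

Lemma beta_free_add_column n (S : filling n) c i :
  beta_free (add_column S c) (lift ord_max i) =
  beta_free S i && (c (lift ord_max i) != cbeta).
Proof.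
apply/forallP/andP => [H|[/forallP H cb] j].
  split; last by rewrite -(add_column0 S).
  by apply/forallP => j; rewrite -(add_column_lift S c).
case: (unliftP ord0 j) => [k ->|->]; last by rewrite add_column0.
by rewrite add_column_lift.
Qed.

Lemma beta_free_add_column_max n (S : filling n) c :
  beta_free (add_column S c) ord_max = (c ord_max != cbeta).
Proof.
apply/forallP/idP => [/(_ ord0)|H j]; first by rewrite add_column0.
case: (unliftP ord0 j) => [k ->|->]; last by rewrite add_column0.
by rewrite add_column_max.
Qed.

(** In a free row the factor [x] survives unless the entry is [cbeta]; in any other row the
    indicator enforces emptiness. *)
Definition entry_weight (x : K) (free second : bool) (s : cell) : K :=
  if free then cell_weight s * mark second s * row_weight x (s != cbeta)
  else (s == None)%:R.

(** The corner must be filled, so [None] weighs 0; with [calpha] the new row is free of [cbeta],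
    whence the factor [x]. *)
Definition corner_weight (x : K) (s : cell) : K :=
  if s is Some s' then if s' then a * x else b else 0.

Definition new_column_weight x n (S : filling n) (i : 'I_n.+1) (s : cell) : K :=
  if unlift ord_max i is Some j then entry_weight x (beta_free S j) (j.+1 == n) s
  else corner_weight x s.

(** The local weights absorb both [column_fits] and the row weights, so that the sum over admissible
    columns becomes a [column_sum]. *)
Lemma prod_new_column_weight x n (S : filling n) (c : column n.+1) :
  \prod_i new_column_weight x S i (c i) =
  (column_fits S c)%:R *
  (\prod_(i : 'I_n.+1) (cell_weight (c i) * mark (i.+1 == n) (c i)) *
   \prod_i row_weight x (beta_free (add_column S c) i)).
Proof.
have lm (i : 'I_n) : lift ord_max i = i :> nat by rewrite lift_max.
rewrite !(bigD1_ord ord_max) //= beta_free_add_column_max.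
rewrite /new_column_weight unlift_none mulrACA -big_split /=.
rewrite /column_fits.
case: (c ord_max) => [s|] /=; last by rewrite mul0r mul0r.
rewrite (eqn_leq n.+1) ltnn /mark /= mulr1.
have -> : (if s then a * x else b) =
    (if s then a else b) * row_weight x (Some s != cbeta).
  by case: s => /=; rewrite ?mulr1.
rewrite mulrCA; congr (_ * _).
case: (boolP [forall i, _]) => /= [/forallP fit|/forallPn[i]].
  rewrite mul1r; apply: eq_bigr => i _; rewrite liftK beta_free_add_column.
  rewrite /entry_weight /mark /bump leqNgt ltn_ord add0n; case: (beta_free S i) (fit i) => //= /eqP ->.
  by rewrite eqxx /= andbF !mulr1.
rewrite negb_or mul0r => /andP[nf ci]; rewrite (bigD1 i) //= liftK.
by rewrite /entry_weight (negPf nf) (negPf ci) mul0r.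
Qed.

Lemma tableau_gfS n x :
  tableau_gf n.+1 x = \sum_(S : filling n | is_ab_staircase S)
    marked_wt S * column_sum (new_column_weight x S).
Proof.
rewrite /tableau_gf sum_staircaseS; apply: eq_bigr => S _.
rewrite /column_sum big_mkcondr big_distrr /=; apply: eq_bigr => c _.
rewrite prod_new_column_weight marked_wt_add_column; case: ifP => _.
  by rewrite mul1r mulrA.
by rewrite mul0r mulr0.
Qed.


(* The proportionality of [g i calpha] and [g i cbeta] makes the sum telescope
   over the position of the unique alpha of a column. *)
Lemma column_sum_telescope n (g : 'I_n -> cell -> K) (p : K) :
  (forall i, b * g i calpha = p * g i cbeta) ->
  b * column_sum g + p * \prod_i g i None =
  (b + p) * \prod_i (g i None + g i cbeta).
Proof.
elim: n g => [|n IH] g gab; first by rewrite column_sum0 !big_ord0 !mulr1.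
rewrite column_sumS !(bigD1_ord ord_max) //= [RHS]mulrCA -(IH (fun i => g (lift ord_max i))) //.
rewrite !mulrDr mulrA gab; ring.
Qed.

Lemma entry_weight_none x free second :
  entry_weight x free second None = row_weight x free.
Proof. by rewrite /entry_weight /mark andbF !mul1r. Qed.

(** A [calpha] in the corner gives [a * x] times the empty column and a [cbeta] gives [b] times a
    full column sum: this is the left side of the telescoping identity with [p = a * x]. *)
Lemma new_column_sum x n (S : filling n) :
  column_sum (new_column_weight x S) =
  (b + a * x) * \prod_(i : 'I_n)
    (row_weight x (beta_free S i) + entry_weight x (beta_free S i) (i.+1 == n) cbeta).
Proof.
rewrite column_sumS /new_column_weight unlift_none /= add0r addrC.
have e i s : new_column_weight x S (lift ord_max i) s =
  entry_weight x (beta_free S i) (i.+1 == n) s.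
  by rewrite /new_column_weight liftK.
rewrite column_sum_telescope => [|i].
  by congr (_ * _); apply: eq_bigr => i _; rewrite liftK entry_weight_none.
rewrite liftK /entry_weight; case: beta_free; rewrite ?mulr0 //=.
rewrite mulr1; ring.
Qed.

(** A bottom row without [cbeta] has [calpha] in its only box, which empties the rest of the first
    column; what remains is an arbitrary tableau of size [n]. *)
Lemma tableau_gf_bottom_free n x :
  \sum_(S : filling n.+1 | is_ab_staircase S && beta_free S ord_max)
    marked_wt S * \prod_(i : 'I_n) row_weight x (beta_free S (lift ord_max i)) =
  a * tableau_gf n x.
Proof.
rewrite big_mkcondr sum_staircaseS /tableau_gf big_distrr; apply: eq_bigr => S _ /=.
pose c0 : column n.+1 := snoc_column [ffun=> None] calpha.
have c0m : c0 ord_max = calpha by rewrite snoc_column_max.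
have c0l i : c0 (lift ord_max i) = None by rewrite snoc_column_lift ffunE.
rewrite -big_mkcondr (big_pred1 c0) => [|c]; last first.
  rewrite beta_free_add_column_max; apply/idP/eqP => [|->].
    case/andP => /andP[/forallP/(_ ord_max)/implyP ok /andP[cm _]] cb.
    have ca : c ord_max = calpha by case: (c ord_max) cm cb => [[]|].
    apply/ffunP => i; case: (unliftP ord_max i) => [k ->|->]; last by rewrite c0m.
    rewrite c0l; apply/eqP; move: ok; rewrite ca => /(_ isT)/forallP/(_ (lift ord_max k)).
    by rewrite lift_max ltn_ord.
  rewrite snoc_column_ok column_ok_none !eqxx /column_fits c0m /= andbT.
  by apply/forallP => i; rewrite c0l orbT.
rewrite marked_wt_add_column (bigD1_ord ord_max) //= c0m big1 => [|i _].
  rewrite (eqn_leq n.+1) ltnn /mark /= !mulr1 [_ * a]mulrC -mulrA.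
  congr (_ * (_ * _)); apply: eq_bigr => i _.
  by rewrite beta_free_add_column c0l andbT.
by rewrite c0l /mark andbF mulr1.
Qed.

Lemma tableau_gf0 x : tableau_gf 0 x = 1.
Proof.
rewrite /tableau_gf (big_pred1 [ffun=> None]) => [|S].
  rewrite big_ord0 mulr1 /marked_wt big1 // => -[[]] //.
have -> : S = [ffun=> None] by apply/ffunP => -[[]].
by rewrite /= eqxx; apply/staircaseP; split => -[].
Qed.

Lemma tableau_gf1 x : tableau_gf 1 x = b + a * x.
Proof.
rewrite tableau_gfS.
under eq_bigr => S _ do rewrite new_column_sum big_ord0 mulr1.
rewrite -big_distrl /= -[RHS]mul1r -(tableau_gf0 x); congr (_ * _).
by apply: eq_bigr => S _; rewrite big_ord0 mulr1.
Qed.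

(* [x + b t = (x + b) + b (t - 1)] for the second-diagonal box of the new column. *)
Lemma tableau_gfSS n x :
  tableau_gf n.+2 x = (b + a * x) *
    (tableau_gf n.+1 (x + b) + a * b * (t - 1) * tableau_gf n (x + b)).
Proof.
have -> : a * b * (t - 1) * tableau_gf n (x + b) =
  b * (t - 1) * (a * tableau_gf n (x + b)) by ring.
rewrite tableau_gfS -tableau_gf_bottom_free.
rewrite /tableau_gf [X in _ = _ * (_ + _ * X)]big_mkcondr big_distrr -big_split big_distrr /=; apply: eq_bigr => S _.
rewrite new_column_sum mulrCA; congr (_ * _).
rewrite !(bigD1_ord ord_max) //= eqxx.
(* Off the second diagonal a free row contributes [x + b] and any other row contributes 1, which is
   the row weight at [x + b]. Only the last old row, split off above, feels [t]. *)
under [X in _ * (_ * X)]eq_bigr => i _.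
  rewrite /bump leqNgt ltn_ord add0n eqSS (ltn_eqF (ltn_ord i)).
  rewrite (_ : _ + _ = row_weight (x + b) (beta_free S (lift ord_max i))); last first.
    by rewrite /row_weight /entry_weight /mark; case: beta_free; rewrite /= ?addr0 ?mulr1.
  over.
rewrite /row_weight /entry_weight /mark; case: beta_free => /=; ring.
Qed.

(** * Closed form of the generating function *)

(** The generating function at [t = 1], where the second term of the recursion vanishes. *)
Definition plain_gf n (x : K) : K := \prod_(i < n) (b + a * (x + b *+ i)).

Lemma plain_gfS n x : plain_gf n.+1 x = (b + a * x) * plain_gf n (x + b).
Proof.
rewrite /plain_gf big_ord_recl mulr0n addr0; congr (_ * _).
by apply: eq_bigr => i _; rewrite /= mulrS addrA.
Qed.

(** Both sides agree for sizes 0 and 1 and satisfy the same two-step recursion; on the right it is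
    Pascal's rule. Terms with [2 r > n] vanish through the binomial. *)
Lemma tableau_gfE n x :
  tableau_gf n x = \sum_(r < n.+1)
    ('C(n - r, r))%:R * (a * b * (t - 1)) ^+ r * plain_gf (n - r) x.
Proof.
set u := a * b * (t - 1).
pose G n x := \sum_(r < n.+1) ('C(n - r, r))%:R * u ^+ r * plain_gf (n - r) x.
have G1 y : G 1%N y = b + a * y.
  rewrite /G !big_ord_recl big_ord0 /plain_gf /= big_ord1.
  by rewrite /= mulr0n addr0 !mul1r mul0r mul0r !addr0.
have GSS m y : G m.+2 y = (b + a * y) * (G m.+1 (y + b) + u * G m (y + b)).
  rewrite /G big_ord_recr /= subnn bin0n !mul0r addr0 big_ord_recl [X in _ = _ * (X + _)]big_ord_recl /=.
  rewrite !subn0 !bin0 plain_gfS -addrA [RHS]mulrDr; congr (_ + _).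
    by rewrite !mul1r.
  rewrite big_distrr -big_split big_distrr; apply: eq_bigr => -[r rm] _ /=.
  rewrite /bump /= add1n !subSS subSn // binS natrD exprS plain_gfS; ring.
suff [] : tableau_gf n x = G n x /\ tableau_gf n.+1 x = G n.+1 x by [].
elim: n x => [|n IH] x.
  rewrite tableau_gf0 tableau_gf1 G1; split => //.
  by rewrite /G big_ord1 /plain_gf big_ord0 !mulr1.
split; first by have [] := IH x.
rewrite tableau_gfSS GSS.
by have [-> ->] := IH (x + b).
Qed.

End Weights.

(** * Extraction of coefficients *)

Lemma coef_XsubC1_exp (K : comNzRingType) r k :
  (('X - 1 : {poly K}) ^+ r)`_k = (-1) ^+ (r - k) * ('C(r, k))%:R.
Proof.
rewrite addrC exprDn coef_sum.
have cE i : (((- 1) ^+ (r - i) * 'X^i : {poly K}) *+ 'C(r, i))`_k =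
    (k == i)%:R * ((-1) ^+ (r - i) * ('C(r, i))%:R).
  rewrite coefMn -(rmorphN1 polyC) -rmorphXn coefCM coefXn -mulr_natr; ring.
under eq_bigr => i _ do rewrite cE.
have [le|lt] := leqP k r; last first.
  rewrite bin_small // mulr0 big1 // => i _.
  by rewrite gtn_eqF ?mul0r // (leq_trans _ lt).
rewrite (bigD1 (Ordinal (n := r.+1) le)) //= eqxx mul1r big1 ?addr0 // => i ne.
rewrite [k == i]eq_sym (_ : (i == k :> nat) = false) ?mul0r //.
exact: negbTE.
Qed.

(** Over polynomials, with [t] the indeterminate, the coefficient of degree [k] selects the tableaux
    with [Xsecond S = k]; at [x = 1] the row weights disappear. *)
Lemma sum_wt_X (K : numFieldType) (a b : K) n k :
  \sum_(S : filling n | is_ab_staircase S && (Xsecond S == k)) wt a b S =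
  \sum_(r < n.+1) ('C(n - r, r))%:R * (a * b) ^+ r * plain_gf a b (n - r) 1 *
    ((-1) ^+ (r - k) * ('C(r, k))%:R).
Proof.
transitivity ((tableau_gf a%:P b%:P 'X n 1)`_k).
  rewrite /tableau_gf coef_sum big_mkcondr; apply: eq_bigr => S _.
  rewrite big1 => [|i _]; last by rewrite /row_weight; case: ifP.
  rewrite mulr1 marked_wtE -!rmorphXn -rmorphM coefCM coefXn eq_sym /wt.
  by case: ifP; rewrite ?mulr1 ?mulr0.
rewrite tableau_gfE coef_sum; apply: eq_bigr => r _.
have -> m : plain_gf a%:P b%:P m 1 = (plain_gf a b m 1)%:P.
  rewrite /plain_gf rmorph_prod; apply: eq_bigr => i _.
  by rewrite rmorphD rmorphM rmorphD rmorphMn rmorph1.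
rewrite exprMn -!rmorphM -rmorphXn -polyC_natr.
rewrite mulrAC mulrA -!rmorphM coefCM coef_XsubC1_exp.
by congr (_ * _); rewrite mulrAC.
Qed.

(** At [t = 1] only the term [r = 0] of the closed form survives. *)
Lemma sum_wt (K : numFieldType) (a b : K) n :
  \sum_(S : filling n | is_ab_staircase S) wt a b S = plain_gf a b n 1.
Proof.
transitivity (tableau_gf a b 1 n 1).
  apply: eq_bigr => S _; rewrite marked_wtE expr1n mulr1 big1 ?mulr1 // => i _.
  by rewrite /row_weight; case: ifP.
rewrite tableau_gfE big_ord_recl big1 => [|i _].
  by rewrite bin0 subn0 !mul1r addr0.
by rewrite subrr mulr0 expr0n mulr0 mul0r.
Qed.

(** * Limits of sums, products and series *)

(** Dominated convergence for sums whose length grows with [n]: cut at an [N] beyond which the tails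
    of [M] and [v] are small, and use termwise convergence on the finite head. *)
Lemma tannery (R : realType) (u : nat -> nat -> R) (v M : nat -> R) (L : R) :
  (forall n r, `|u n r| <= M r) -> cvgn (series M) ->
  (forall r, u n r @[n --> \oo] --> v r) -> series v @ \oo --> L ->
  \sum_(r < n.+1) u n r @[n --> \oo] --> L.
Proof.
move=> uM cM uv cv.
have M0 r : 0 <= M r by apply: le_trans (uM 0 r).
have ndM : nondecreasing_seq (series M).
  move=> m n mn; rewrite -subr_ge0 sub_series_geq //; exact: sumr_ge0.
apply/cvgrPdist_le => e e0; have e3 : 0 < e / 3 by rewrite divr_gt0.
have [N [MN vN]] : exists N, `|limn (series M) - series M N| <= e / 3 /\
    `|L - series v N| <= e / 3.
  near \oo => N; exists N; split; near: N.
    by move/cvgrPdist_le : cM; exact.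
  by move/cvgrPdist_le : cv; exact.
have cu : \sum_(0 <= r < N) u n r @[n --> \oo] --> series v N.
  apply: cvg_big => [|r _]; [exact: add_continuous | exact: uv].
near=> n.
have Nn : (N <= n.+1)%N by rewrite leqW //; near: n; exact: nbhs_infty_ge.
have uN : `|series v N - \sum_(0 <= r < N) u n r| <= e / 3.
  by near: n; move/cvgrPdist_le : cu; exact.
(* Beyond [N] the sum is dominated by a piece of [series M], whose partial sums stay below their
   limit. *)
have tail : `|\sum_(N <= r < n.+1) u n r| <= e / 3.
  apply: le_trans (ler_norm_sum _ _ _) _.
  apply: le_trans (ler_sum _ (fun r _ => uM n r)) _.
  rewrite -sub_series_geq //; apply: le_trans MN.
  apply: le_trans (ler_norm _); rewrite lerD2r.
  exact: nondecreasing_cvgn_le.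
rewrite -(big_mkord xpredT) (big_cat_nat _ Nn) //=.
rewrite (_ : L - _ = (L - series v N) + (series v N - \sum_(0 <= r < N) u n r)
   - \sum_(N <= r < n.+1) u n r); last by ring.
apply: le_trans (ler_normB _ _) _.
apply: le_trans (lerD (ler_normD _ _) (lexx _)) _.
lra.
Unshelve. all: by end_near.
Qed.

(** The ratio is 1 minus [c] over a denominator that tends to infinity. *)
Lemma cvg_affine_ratio (R : realType) (c d : R) : 0 < c -> 0 < d ->
  m%:R * d / (c + m%:R * d) @[m --> \oo] --> (1 : R).
Proof.
move=> c0 d0.
have pos m : 0 < c + m%:R * d by rewrite ltr_pwDl // mulr_ge0 // ltW.
have -> : (fun m => m%:R * d / (c + m%:R * d)) =
    (fun m => 1 - c * (c + m%:R * d)^-1).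
  apply/funext => m; have := pos m; move: (m%:R) => y yp.
  by field; rewrite gt_eqF.
rewrite -[X in _ --> X](subr0 1) -[X in 1 - X](mulr0 c).
apply: cvgB; first exact: cvg_cst.
apply: cvgMr; apply/gtr0_cvgV0; first by apply: nearW => m; exact: pos.
apply/cvgryPge => A; near=> m.
rewrite -lerBlDl -ler_pdivrMr //.
near: m; exact: nbhs_infty_ger.
Unshelve. all: by end_near.
Qed.

Lemma cvg_prod_ord (R : realType) r (f : nat -> nat -> R) (l : nat -> R) :
  (forall i, f n i @[n --> \oo] --> l i) ->
  \prod_(i < r) f n i @[n --> \oo] --> \prod_(i < r) l i.
Proof.
move=> fl; apply: cvg_big => //; exact: mul_continuous.
Qed.

(** The terms with [r < k] vanish, and for [r = s + k] the binomial over [r!] is [1 / (s! k!)],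
    which leaves the exponential series. The case [z = -1] gives the limit, [z = 1] the dominating
    series. *)
Lemma series_binomial_exp (R : realType) (z : R) k :
  series (fun r => z ^+ (r - k) * ('C(r, k))%:R / (r`!)%:R) @ \oo -->
  expR z / (k`!)%:R.
Proof.
rewrite -(cvg_shiftn k) /=.
have -> : (fun n => series (fun r => z ^+ (r - k) * ('C(r, k))%:R / (r`!)%:R) (n + k)%N) =
   (fun n => series (exp_coeff z) n / (k`!)%:R).
  apply/funext => n; rewrite /series /= addnC (big_cat_nat _ (leq_addr n k)) //=.
  rewrite big_nat big1 => [|r /andP[_ rk]]; last first.
    by rewrite bin_small // mulr0 mul0r.
  rewrite add0r -{1}[k]add0n big_addn addKn big_distrl; apply: eq_bigr => s _.
  rewrite addnK /exp_coeff /= -mulrA -[RHS]mulrA; congr (_ * _).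
  have f0 m : (m`!)%:R != 0 :> R by rewrite pnatr_eq0 -lt0n fact_gt0.
  rewrite -(bin_fact (leq_addl s k)) addnK !natrM.
  have b0 : 'C(s + k, k)%:R != 0 :> R by rewrite pnatr_eq0 -lt0n bin_gt0 leq_addl.
  by field; rewrite !f0 b0.
by apply: cvgMl; exact: is_cvg_series_exp_coeff.
Qed.

(** * Asymptotics of the probabilities *)

(** The first [m] factors of the denominator cancel; the other [r] are paired with those of the
    falling factorial [m (m - 1) ... (m - r + 1)]. For [r > m] both sides are 0. *)
Lemma plain_gf_ratio (K : numFieldType) (a b : K) m r : 0 < a -> 0 < b ->
  ('C(m, r))%:R * (a * b) ^+ r * plain_gf a b m 1 / plain_gf a b (m + r) 1 =
  (r`!)%:R^-1 * \prod_(i < r)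
    ((m - i)%:R * (a * b) / (a + b + (m + i)%:R * (a * b))).
Proof.
move=> a0 b0.
have gt0 i : 0 < b + a * (1 + b *+ i).
  by rewrite addr_gt0 // mulr_gt0 // ltr_pwDl // mulrn_wge0 // ltW.
have gf0 n : plain_gf a b n 1 != 0.
  by rewrite gt_eqF // prodr_gt0 // => i _; exact: gt0.
rewrite /plain_gf big_split_ord /= -/(plain_gf a b m 1).
have -> : \prod_(i < r) (b + a * (1 + b *+ (m + i))) =
    \prod_(i < r) (a + b + (m + i)%:R * (a * b)).
  by apply: eq_bigr => i _; rewrite -mulr_natr; ring.
rewrite prodf_div big_split /= prodr_const card_ord.
rewrite -[\prod_(i < r) (m - i)%:R]natr_prod -ffact_prod -bin_ffact natrM.
have p0 : \prod_(i < r) (a + b + (m + i)%:R * (a * b)) != 0.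
  by apply/prodf_neq0 => i _; rewrite gt_eqF // ltr_pwDl ?addr_gt0 //
    mulr_ge0 // ltW // mulr_gt0.
have f0 : (r`!)%:R != 0 :> K by rewrite pnatr_eq0 -lt0n fact_gt0.
by field; rewrite f0 p0 gf0.
Qed.

(** For variables with values in the natural numbers, convergence in distribution to a Poisson
    variable amounts to convergence of each point probability. *)
Theorem theorem3p9 (R : realType) (alpha beta : R) (ha : 0 < alpha) (hb : 0 < beta) :
  forall k : nat,
    prob_X_eq alpha beta n k @[n --> \oo] --> (expR (-1) / (k`!)%:R : R).
Proof.
move=> k; set c := alpha + beta; set d := alpha * beta.
have c0 : 0 < c by rewrite addr_gt0.
have d0 : 0 < d by rewrite mulr_gt0.
pose f n r i : R := (n - r - i)%:R * d / (c + (n - r + i)%:R * d).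
pose u n r : R := (r`!)%:R^-1 * \prod_(i < r) f n r i *
  ((-1) ^+ (r - k) * ('C(r, k))%:R).
have -> : (fun n => prob_X_eq alpha beta n k) = (fun n => \sum_(r < n.+1) u n r).
  apply/funext => n; rewrite /prob_X_eq sum_wt sum_wt_X big_distrl.
  apply: eq_bigr => -[r rn] _ /=; rewrite mulrAC /u /f; congr (_ * _).
  by rewrite -plain_gf_ratio // subnK.
(* Since [n - r - i <= n - r + i] and [c > 0], the products of these factors are at most 1, which
   gives a bound uniform in [n]. *)
have f01 n r i : 0 <= f n r i <= 1.
  have D0 : 0 < c + (n - r + i)%:R * d by rewrite ltr_pwDl // mulr_ge0 // ltW.
  rewrite /f; apply/andP; split; first by rewrite divr_ge0 ?mulr_ge0 // ltW.
  rewrite ler_pdivrMr // mul1r.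
  apply: (@le_trans _ _ ((n - r + i)%:R * d)); last by rewrite lerDr ltW.
  by rewrite ler_wpM2r ?(ltW d0) // ler_nat (leq_trans (leq_subr _ _)) // leq_addr.
apply: (tannery (M := fun r => 1 ^+ (r - k) * ('C(r, k))%:R / (r`!)%:R)
  (v := fun r => (-1) ^+ (r - k) * ('C(r, k))%:R / (r`!)%:R)).
- move=> n r; rewrite !normrM normrX normrN1 !expr1n !mul1r normfV !normr_nat.
  rewrite mulrAC [_^-1 * _]mulrC ler_piMr // ?mulr_ge0 // ?invr_ge0 //.
  rewrite normr_prod; apply: prodr_ile1 => i _.
  by have /andP[? ?] := f01 n r i; rewrite normr_ge0 ger0_norm.
- by apply: cvgP; exact: series_binomial_exp.
- move=> r.
  have flim i : f n r i @[n --> \oo] --> (1 : R).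
    (* After a shift by [r + i] the truncated subtractions are exact and the numerator is
       [n * d]. *)
    rewrite -(cvg_shiftn (r + i)) /=.
    have -> : (fun n => f (n + (r + i))%N r i) =
        (fun n => n%:R * d / ((c + (i + i)%:R * d) + n%:R * d)).
      apply/funext => n; rewrite /f addnCA addKn addnK.
      by rewrite -addnA [(n + _)%N]addnC natrD mulrDl addrA.
    by apply: cvg_affine_ratio => //; rewrite ltr_pwDl // mulr_ge0 // ltW.
  have -> : (-1) ^+ (r - k) * ('C(r, k))%:R / (r`!)%:R =
      (r`!)%:R^-1 * \prod_(i < r) 1 * ((-1) ^+ (r - k) * ('C(r, k))%:R) :> R.
    by rewrite big1 // mulr1 mulrC.
  by apply: cvgMl; apply: cvgMr; exact: (@cvg_prod_ord R r (fun n i => f n r i) (fun=> 1)).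
- exact: series_binomial_exp.
Qed.
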